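(* For every real number $x \in [\frac{2}{\mu}, 2 - \frac{2}{\mu}]$, where $\mu = \frac{5+\sqrt{21}}{2}$, there exist $a, b \in C_{\mathrm{NICF}}$ such that $a + b = x$.
   Context: Notation: for integers $a_0,\ldots,a_n$ and real $z$, $[a_0;a_1,\ldots,a_n:z]$ denotes $a_0+\cfrac{1}{a_1+\cfrac{1}{\ddots+\cfrac{1}{a_n+\frac1z}}}$ (for $n=0$: $a_0+1/z$). Let $\mu=\frac{5+\sqrt{21}}{2}$. For a finite integer sequence $\bar a=(a_0,\ldots,a_n)$ and integer $k$ put $P_{k^+}(\bar a)=[a_0;a_1,\ldots,a_n,k:\mu]$ and $P_{k^-}(\bar a)=[a_0;a_1,\ldots,a_n,k:-\mu]$, and let $T_{u,v}(\bar a)$ be the closed interval with endpoints $P_{u^+}(\bar a)$ and $P_{v^-}(\bar a)$. Let $T_{0,1}=[1/\mu,\,1-1/\mu]$. The Cantor set $C_{\mathrm{NICF}}$ is constructed from the initial interval $T_{0,1}$ by repeatedly removing an open gap from each interval, the two closed pieces that remain being the next intervals, according to the rules (where $(\bar a,b)$ denotes $\bar a$ with $b$ appended): (1) $T_{0,1}$: gap is the open interval between $[0;2:\mu]$ and $[1;-2:-\mu]$; remaining intervals $T_{2,5}((0))$ and $T_{-5,-2}((1))$. (2) $T_{b,b+1}(\bar a)$ with $b\in\{-5,-4,-3,2,3,4\}$: gap between $P_{2^+}((\bar a,b))$ and $P_{-2^-}((\bar a,b+1))$; remaining $T_{2,5}((\bar a,b))$ and $T_{-5,-2}((\bar a,b+1))$.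 (3) $T_{2,5}(\bar a)$: gap between $P_{3^-}(\bar a)$ and $P_{3^+}(\bar a)$; remaining $T_{2,3}(\bar a)$, $T_{3,5}(\bar a)$. (4) $T_{3,5}(\bar a)$: gap between $P_{4^-}(\bar a)$ and $P_{4^+}(\bar a)$; remaining $T_{3,4}(\bar a)$, $T_{4,5}(\bar a)$. (5) $T_{-5,-2}(\bar a)$: gap between $P_{-3^-}(\bar a)$ and $P_{-3^+}(\bar a)$; remaining $T_{-5,-3}(\bar a)$, $T_{-3,-2}(\bar a)$. (6) $T_{-5,-3}(\bar a)$: gap between $P_{-4^-}(\bar a)$ and $P_{-4^+}(\bar a)$; remaining $T_{-5,-4}(\bar a)$, $T_{-4,-3}(\bar a)$. In each case the gap lies inside the interval and the interval is the disjoint union of the gap and the two remaining intervals. Let $\mathcal{F}$ be the family of intervals obtained from $T_{0,1}$ by iterating these rules; then $C_{\mathrm{NICF}}=T_{0,1}\setminus\bigcup_{I\in\mathcal{F}}(\text{gap of }I)$. *)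

(* Defs.v *)
From Stdlib Require Import Reals ZArith List.
Import ListNotations.
Open Scope R_scope.

Definition mu : R := (5 + sqrt 21) / 2.

(* [cf [a0; ...; an] z] is [a0; a1, ..., an : z]; the empty sequence gives z,
   so that [cf [a0] z] is a0 + 1/z. *)
Fixpoint cf (a : list Z) (z : R) : R :=
  match a with
  | [] => z
  | k :: a' => IZR k + 1 / cf a' z
  end.

Definition Pplus (k : Z) (a : list Z) : R := cf (a ++ [k]) mu.
Definition Pminus (k : Z) (a : list Z) : R := cf (a ++ [k]) (- mu).

(* The order of the endpoints P_{u+}(a) and P_{v-}(a) depends on the parity of
   the length of a, so intervals are given by unordered endpoints. *)
Definition closed_between (p q x : R) : Prop := Rmin p q <= x <= Rmax p q.
Definition open_between (p q x : R) : Prop := Rmin p q < x < Rmax p q.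

Inductive interval : Type :=
| T01 : interval
| T : Z -> Z -> list Z -> interval.

Definition points (I : interval) : R -> Prop :=
  match I with
  | T01 => closed_between (1 / mu) (1 - 1 / mu)
  | T u v a => closed_between (Pplus u a) (Pminus v a)
  end.

(* [splits I p q J K]: the gap of I is the open interval between p and q, and
   the remaining intervals are J and K. *)
Inductive splits : interval -> R -> R -> interval -> interval -> Prop :=
| splits_T01 :
    splits T01 (cf [0; 2]%Z mu) (cf [1; -2]%Z (- mu))
      (T 2 5 [0%Z]) (T (-5) (-2) [1%Z])
| splits_succ (b : Z) (a : list Z) :
    In b [-5; -4; -3; 2; 3; 4]%Z ->
    splits (T b (b + 1) a)
      (Pplus 2 (a ++ [b])) (Pminus (-2) (a ++ [(b + 1)%Z]))
      (T 2 5 (a ++ [b])) (T (-5) (-2) (a ++ [(b + 1)%Z]))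
| splits_2_5 (a : list Z) :
    splits (T 2 5 a) (Pminus 3 a) (Pplus 3 a) (T 2 3 a) (T 3 5 a)
| splits_3_5 (a : list Z) :
    splits (T 3 5 a) (Pminus 4 a) (Pplus 4 a) (T 3 4 a) (T 4 5 a)
| splits_m5_m2 (a : list Z) :
    splits (T (-5) (-2) a) (Pminus (-3) a) (Pplus (-3) a)
      (T (-5) (-3) a) (T (-3) (-2) a)
| splits_m5_m3 (a : list Z) :
    splits (T (-5) (-3) a) (Pminus (-4) a) (Pplus (-4) a)
      (T (-5) (-4) a) (T (-4) (-3) a).

Inductive family : interval -> Prop :=
| family_init : family T01
| family_left I p q J K : family I -> splits I p q J K -> family J
| family_right I p q J K : family I -> splits I p q J K -> family K.

Definition C_NICF (x : R) : Prop :=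
  points T01 x /\
  ~ (exists I p q J K, family I /\ splits I p q J K /\ open_between p q x).

(* Main.v *)
From Stdlib Require Import Reals ZArith List Lra Classical.
Require Import Defs.
Import ListNotations.
Open Scope R_scope.

(** Hall's argument.  Every gap is at most as long as each of the two intervals
    it leaves, and gaps do not grow when one passes to a child.  Start with a
    pair of intervals whose sum contains [x] and keep splitting the member with
    the larger gap: since this gap is at most as long as the other interval, one
    of the two pieces still works.  Gaps have positive length, so both members
    are split infinitely often, and the nested pairs converge to [a + b = x].

    For the length estimates, [cf a y] has the form [E + k / (y + r)] with
    [-2/5 <= r <= 5/8] if the digits following [a] are positive; if they are
    negative, [cf a (- y)] has this form.  All inequalities then reduce to the
    images of finitely many configurations of four points. *)

(** * Sums of Cantor sets *)

(** The gap of [i] is the open interval from [hi (l i)] to [lo (r i)]. The child maps are total, so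
    the conditions are restricted to [good] nodes, a class closed under both maps. *)
Record bridged_tree {X : Type} (lo hi : X -> R) (l r : X -> X)
    (good : X -> Prop) : Prop := {
  good_l : forall i, good i -> good (l i);
  good_r : forall i, good i -> good (r i);
  lo_l : forall i, good i -> lo (l i) = lo i;
  hi_r : forall i, good i -> hi (r i) = hi i;
  gap_pos : forall i, good i -> hi (l i) < lo (r i);
  gap_le_l : forall i, good i -> lo (r i) - hi (l i) <= hi (l i) - lo i;
  gap_le_r : forall i, good i -> lo (r i) - hi (l i) <= hi i - lo (r i);
  gap_anti_l : forall i, good i ->
    lo (r (l i)) - hi (l (l i)) <= lo (r i) - hi (l i);
  gap_anti_r : forall i, good i ->
    lo (r (r i)) - hi (l (r i)) <= lo (r i) - hi (l i) }.

Inductive descendant {X : Type} (l r : X -> X) (i : X) : X -> Prop :=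
| descendant_refl : descendant l r i i
| descendant_l j : descendant l r i j -> descendant l r i (l j)
| descendant_r j : descendant l r i j -> descendant l r i (r j).

Definition cantor {X : Type} (lo hi : X -> R) (l r : X -> X) (i : X) (a : R) :=
  lo i <= a <= hi i /\
  forall j, descendant l r i j -> ~ (hi (l j) < a < lo (r j)).

Definition is_child {X : Type} (l r : X -> X) (i j : X) := j = l i \/ j = r i.

(** Keeps only what convergence needs from the splitting process, in a form symmetric in [s] and
    [t], so that one argument serves both coordinates. *)
Definition larger_gap_moves {X : Type} (lo hi : X -> R) (l r : X -> X)
    (s t : nat -> X) :=
  forall n,
    (is_child l r (s n) (s (S n)) /\ t (S n) = t n /\
     lo (r (t n)) - hi (l (t n)) <= lo (r (s n)) - hi (l (s n))) \/
    (is_child l r (t n) (t (S n)) /\ s (S n) = s n /\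
     lo (r (s n)) - hi (l (s n)) <= lo (r (t n)) - hi (l (t n))).

Lemma larger_gap_moves_sym {X : Type} (lo hi : X -> R) (l r : X -> X) s t :
  larger_gap_moves lo hi l r s t -> larger_gap_moves lo hi l r t s.
Proof. intros H n. destruct (H n); tauto. Qed.

Lemma good_descendant {X : Type} (lo hi : X -> R) (l r : X -> X) good i j :
  bridged_tree lo hi l r good -> good i -> descendant l r i j -> good j.
Proof.
  intros B Hi D. induction D; [assumption | now apply (good_l _ _ _ _ _ B) |
    now apply (good_r _ _ _ _ _ B)].
Qed.

(* If [s] stood still for ever, each move of [t] would remove from its interval
   a gap of at least the fixed positive length of the gap of [s n]. *)
Lemma moves_eventually {X : Type} (lo hi : X -> R) (l r : X -> X) good s t :
  bridged_tree lo hi l r good ->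
  (forall n, good (s n)) -> (forall n, good (t n)) ->
  larger_gap_moves lo hi l r s t ->
  forall n, exists m, s m = s n /\ is_child l r (s m) (s (S m)).
Proof.
  intros B Gs Gt H n. apply NNPP. intros N.
  set (g := lo (r (s n)) - hi (l (s n))).
  assert (Hg : 0 < g) by (pose proof (gap_pos _ _ _ _ _ B _ (Gs n)); unfold g; lra).
  assert (St : forall k, s (n + k)%nat = s n /\
    hi (t (n + k)%nat) - lo (t (n + k)%nat) <= hi (t n) - lo (t n) - INR k * g).
  { induction k as [|k [IH1 IH2]].
    - rewrite Nat.add_0_r. simpl. split; [reflexivity | lra].
    - rewrite Nat.add_succ_r, S_INR. set (m := (n + k)%nat) in *.
      destruct (H m) as [[C _] | [C [E L]]].
      + exfalso. apply N. now exists m.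
      + split; [congruence|].
        rewrite IH1 in L. fold g in L.
        pose proof (gap_le_l _ _ _ _ _ B _ (Gt m)).
        pose proof (gap_le_r _ _ _ _ _ B _ (Gt m)).
        pose proof (lo_l _ _ _ _ _ B _ (Gt m)).
        pose proof (hi_r _ _ _ _ _ B _ (Gt m)).
        destruct C as [C | C]; rewrite C; lra. }
  destruct (INR_archimed g (hi (t n) - lo (t n)) Hg) as [k Hk].
  destruct (St k) as [_ Hl].
  pose proof (gap_pos _ _ _ _ _ B _ (Gt (n + k)%nat)).
  pose proof (gap_le_l _ _ _ _ _ B _ (Gt (n + k)%nat)).
  pose proof (gap_le_r _ _ _ _ _ B _ (Gt (n + k)%nat)).
  lra.
Qed.

(** Sibling intervals are disjoint, so every descendant interval containing [a] is visited by the
    branch. The branch later enters one of its pieces, which contains [a]; hence [a] misses the gap.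
    The sequence may pause at a node, but by the third hypothesis not for ever. *)
Lemma cantor_of_branch {X : Type} (lo hi : X -> R) (l r : X -> X) good s a :
  bridged_tree lo hi l r good -> (forall n, good (s n)) ->
  (forall n, exists m, s m = s n /\ is_child l r (s m) (s (S m))) ->
  (forall n, lo (s n) <= a <= hi (s n)) ->
  cantor lo hi l r (s O) a.
Proof.
  intros B G M Ha. split; [apply Ha|].
  assert (next : forall n, (lo (l (s n)) <= a <= hi (l (s n)) /\
      exists m, s m = l (s n)) \/
      (lo (r (s n)) <= a <= hi (r (s n)) /\ exists m, s m = r (s n))).
  { intros n. destruct (M n) as [m [E C]]. rewrite E in C.
    pose proof (Ha (S m)) as H.
    destruct C as [C | C]; rewrite C in H; [left | right]; eauto. }
  (* If a child contains [a], so does its parent, which is visited by induction; the piece entered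
     next must be this child, the other one being disjoint from it. *)
  assert (K : forall j, descendant l r (s O) j -> lo j <= a <= hi j ->
    exists n, s n = j).
  { intros j D.
    induction D as [|j D IH|j D IH]; intros Hj; [now exists O | |];
    pose proof (good_descendant _ _ _ _ _ _ _ B (G O) D) as Gj;
    pose proof (gap_pos _ _ _ _ _ B _ Gj);
    pose proof (gap_le_l _ _ _ _ _ B _ Gj);
    pose proof (gap_le_r _ _ _ _ _ B _ Gj);
    pose proof (lo_l _ _ _ _ _ B _ Gj);
    pose proof (hi_r _ _ _ _ _ B _ Gj);
    (destruct IH as [n E]; [lra|]); subst j;
    destruct (next n) as [[Q E] | [Q E]]; try assumption; lra. }
  intros j D Hgap.
  pose proof (good_descendant _ _ _ _ _ _ _ B (G O) D) as Gj.
  pose proof (gap_le_l _ _ _ _ _ B _ Gj).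
  pose proof (gap_le_r _ _ _ _ _ B _ Gj).
  destruct (K j D) as [n E]; [lra|]. subst j.
  destruct (next n) as [[Q _] | [Q _]]; lra.
Qed.

Definition sum_step {X : Type} (lo hi : X -> R) (l r : X -> X) (x : R)
    (c : X * X) : X * X :=
  let (i, j) := c in
  if Rle_dec (lo (r j) - hi (l j)) (lo (r i) - hi (l i))
  then (if Rle_dec x (hi (l i) + hi j) then (l i, j) else (r i, j))
  else (if Rle_dec x (hi i + hi (l j)) then (i, l j) else (i, r j)).

Definition linked {X : Type} (lo hi : X -> R) (l r : X -> X)
    (good : X -> Prop) (x : R) (c : X * X) : Prop :=
  let (i, j) := c in
  good i /\ good j /\ lo i + lo j <= x <= hi i + hi j /\
  lo (r i) - hi (l i) <= hi j - lo j /\ lo (r j) - hi (l j) <= hi i - lo i.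

(** If [i] is split and [x] exceeds [hi (l i) + hi j], then [x] exceeds [lo (r i) + lo j], because
    the gap of [i] is at most the length of [j]. The linking bounds survive: the new gap is no
    larger than the old one, and the gap of [j] is at most that of [i], hence at most either piece
    of [i]. *)
Lemma linked_step {X : Type} (lo hi : X -> R) (l r : X -> X) good x c :
  bridged_tree lo hi l r good -> linked lo hi l r good x c ->
  linked lo hi l r good x (sum_step lo hi l r x c).
Proof.
  intros B. destruct c as [i j]. intros (Gi & Gj & Hx & H1 & H2).
  pose proof (gap_pos _ _ _ _ _ B _ Gi). pose proof (gap_pos _ _ _ _ _ B _ Gj).
  pose proof (gap_le_l _ _ _ _ _ B _ Gi). pose proof (gap_le_l _ _ _ _ _ B _ Gj).
  pose proof (gap_le_r _ _ _ _ _ B _ Gi). pose proof (gap_le_r _ _ _ _ _ B _ Gj).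
  pose proof (lo_l _ _ _ _ _ B _ Gi). pose proof (lo_l _ _ _ _ _ B _ Gj).
  pose proof (hi_r _ _ _ _ _ B _ Gi). pose proof (hi_r _ _ _ _ _ B _ Gj).
  pose proof (gap_anti_l _ _ _ _ _ B _ Gi). pose proof (gap_anti_l _ _ _ _ _ B _ Gj).
  pose proof (gap_anti_r _ _ _ _ _ B _ Gi). pose proof (gap_anti_r _ _ _ _ _ B _ Gj).
  pose proof (good_l _ _ _ _ _ B _ Gi). pose proof (good_l _ _ _ _ _ B _ Gj).
  pose proof (good_r _ _ _ _ _ B _ Gi). pose proof (good_r _ _ _ _ _ B _ Gj).
  unfold sum_step, linked.
  destruct Rle_dec; destruct Rle_dec; repeat split; try assumption; lra.
Qed.

Theorem sum_of_cantor {X : Type} (lo hi : X -> R) (l r : X -> X) good i x :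
  bridged_tree lo hi l r good -> good i ->
  lo i + lo i <= x <= hi i + hi i ->
  exists a b, cantor lo hi l r i a /\ cantor lo hi l r i b /\ a + b = x.
Proof.
  intros B Gi Hx.
  set (c := fun n => Nat.iter n (sum_step lo hi l r x) (i, i)).
  set (s := fun n => fst (c n)). set (t := fun n => snd (c n)).
  assert (L : forall n, linked lo hi l r good x (c n)).
  { induction n as [|n IH].
    - pose proof (gap_pos _ _ _ _ _ B _ Gi).
      pose proof (gap_le_l _ _ _ _ _ B _ Gi).
      pose proof (gap_le_r _ _ _ _ _ B _ Gi).
      simpl. repeat split; try assumption; lra.
    - now apply linked_step. }
  assert (L' : forall n, good (s n) /\ good (t n) /\
      lo (s n) + lo (t n) <= x <= hi (s n) + hi (t n)).
  { intros n. pose proof (L n) as Ln. unfold s, t.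
    destruct (c n). simpl in *. tauto. }
  assert (Gs : forall n, good (s n)) by apply L'.
  assert (Gt : forall n, good (t n)) by apply L'.
  assert (M : larger_gap_moves lo hi l r s t).
  { intros n. unfold s, t, is_child.
    change (c (S n)) with (sum_step lo hi l r x (c n)).
    destruct (c n) as [p q]. unfold sum_step.
    destruct Rle_dec; destruct Rle_dec; simpl;
    [left | left | right | right]; repeat split; auto; lra. }
  assert (len : forall j, good j -> lo j < hi j).
  { intros j G. pose proof (gap_pos _ _ _ _ _ B _ G).
    pose proof (gap_le_l _ _ _ _ _ B _ G).
    pose proof (gap_le_r _ _ _ _ _ B _ G). lra. }
  assert (nest : forall u v, is_child l r u v -> good u ->
    lo u <= lo v /\ hi v <= hi u).
  { intros u v C G. pose proof (gap_pos _ _ _ _ _ B _ G).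
    pose proof (gap_le_l _ _ _ _ _ B _ G).
    pose proof (gap_le_r _ _ _ _ _ B _ G).
    pose proof (lo_l _ _ _ _ _ B _ G).
    pose proof (hi_r _ _ _ _ _ B _ G).
    destruct C; subst v; lra. }
  assert (mono : forall n k,
    lo (s n) <= lo (s (n + k)%nat) /\ hi (s (n + k)%nat) <= hi (s n) /\
    lo (t n) <= lo (t (n + k)%nat) /\ hi (t (n + k)%nat) <= hi (t n)).
  { intros n k. induction k as [|k IH].
    - rewrite Nat.add_0_r. lra.
    - rewrite Nat.add_succ_r.
      destruct (M (n + k)%nat) as [[C [E _]] | [C [E _]]]; rewrite E;
      apply nest in C; auto; lra. }
  (* These are the lower bounds on [a] imposed by [a] in [s n] and [x - a] in [t n]; [a] will be
     their supremum. *)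
  set (A := fun y => exists n, y = Rmax (lo (s n)) (x - hi (t n))).
  (* Lower and upper bounds from different stages are compared at the common later stage [n + m]. *)
  assert (cross : forall n m, Rmax (lo (s n)) (x - hi (t n)) <=
      Rmin (hi (s m)) (x - lo (t m))).
  { intros n m. pose proof (mono n m) as H1. pose proof (mono m n) as H2.
    rewrite Nat.add_comm in H2.
    pose proof (len _ (Gs (n + m)%nat)). pose proof (len _ (Gt (n + m)%nat)).
    destruct (L' (n + m)%nat) as (_ & _ & H3).
    apply Rmax_lub; apply Rmin_glb; lra. }
  destruct (completeness A) as [a [Ub Lub]].
  { exists (Rmin (hi (s O)) (x - lo (t O))). intros y [n ->]. apply cross. }
  { eexists. exists O. reflexivity. }
  assert (Ha : forall n, lo (s n) <= a <= hi (s n) /\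
    lo (t n) <= x - a <= hi (t n)).
  { intros n.
    assert (H1 : Rmax (lo (s n)) (x - hi (t n)) <= a) by (apply Ub; now exists n).
    assert (H2 : a <= Rmin (hi (s n)) (x - lo (t n))).
    { apply Lub. intros y [m ->]. apply cross. }
    pose proof (Rmax_l (lo (s n)) (x - hi (t n))).
    pose proof (Rmax_r (lo (s n)) (x - hi (t n))).
    pose proof (Rmin_l (hi (s n)) (x - lo (t n))).
    pose proof (Rmin_r (hi (s n)) (x - lo (t n))). lra. }
  exists a, (x - a). split; [|split; [|ring]].
  - change i with (s O). apply (cantor_of_branch lo hi l r good); auto.
    + now apply (moves_eventually lo hi l r good s t B).
    + apply Ha.
  - change i with (t O). apply (cantor_of_branch lo hi l r good); auto.
    + apply (moves_eventually lo hi l r good t s B); auto.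
      now apply (larger_gap_moves_sym lo hi l r s t).
    + apply Ha.
Qed.

(** * Pole form of the branches *)

Definition bridge (s p q t : R) :=
  s < p /\ p < q /\ q < t /\ q - p <= p - s /\ q - p <= t - q.

(** Both orders are allowed because [cf a] reverses orientation according to the parity of the
    length of [a]. *)
Definition bridged (s p q t : R) := bridge s p q t \/ bridge t q p s.

Lemma bridged_sym s p q t : bridged s p q t -> bridged t q p s.
Proof. unfold bridged; tauto. Qed.

Lemma bridged_affine E k s p q t :
  k <> 0 -> bridged s p q t ->
  bridged (E + k * s) (E + k * p) (E + k * q) (E + k * t).
Proof.
  intros Hk H. unfold bridged, bridge in *.
  destruct (Rdichotomy k 0 Hk); destruct H; [right | left | left | right];
  repeat split; nra.
Qed.

(** * The constant [1 / mu] and numerical bounds *)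

Definition delta : R := 1 / mu.

Lemma mu_bounds : 4.79 < mu < 4.792.
Proof.
  unfold mu. pose proof (sqrt_pos 21).
  pose proof (sqrt_sqrt 21 ltac:(lra)). split; nra.
Qed.

Lemma delta_bounds : 0.208 < delta < 0.209.
Proof.
  pose proof mu_bounds. assert (delta * mu = 1) by (unfold delta; field; lra).
  split; nra.
Qed.

(** Follows from [mu * mu = 5 * mu - 1]. It makes the outer end of a piece with next digit 5 or -5
    coincide with an end of the parent interval. *)
Lemma delta_fixed : 1 / (5 - delta) = delta.
Proof.
  pose proof mu_bounds. assert (H0 : mu * mu = 5 * mu - 1).
  { unfold mu. pose proof (sqrt_sqrt 21 ltac:(lra)). nra. }
  unfold delta. field_simplify_eq; [nra | split; lra].
Qed.

(** Distance from the nearer digit to either end of the gap of [T b (b + 1) a], before [cf a] is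
    applied. *)
Definition inv2 : R := 1 / (2 + delta).

Lemma inv2_bounds : 0.452 < inv2 < 0.453.
Proof.
  pose proof delta_bounds.
  assert (inv2 * (2 + delta) = 1) by (unfold inv2; field; lra). split; nra.
Qed.

Lemma inv3m_bounds : 0.358 < 1 / (3 - delta) < 0.359.
Proof.
  pose proof delta_bounds.
  assert (1 / (3 - delta) * (3 - delta) = 1) by (field; lra). split; nra.
Qed.

Lemma inv3p_bounds : 0.311 < 1 / (3 + delta) < 0.312.
Proof.
  pose proof delta_bounds.
  assert (1 / (3 + delta) * (3 + delta) = 1) by (field; lra). split; nra.
Qed.

(* The bounds on the pole [-r] are stable under [pole_form_add] and
   [pole_form_sub], since [1/(2 - 2/5) = 5/8] and [1/(3 - 2/5) < 2/5]. *)
Definition pole_form (g : R -> R) : Prop :=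
  exists E k r, k <> 0 /\ - (2 / 5) <= r <= 5 / 8 /\
    forall y, 1 < y -> g y = E + k * / (y + r).

Lemma pole_form_ext g h :
  (forall y, 1 < y -> g y = h y) -> pole_form g -> pole_form h.
Proof.
  intros H (E & k & r & Hk & Hr & Hg). exists E, k, r.
  repeat split; try tauto. intros y Hy. rewrite <- H; auto.
Qed.

(** With [B = b + r], one has [k / (B + 1 / y) = k / B - (k / B ^ 2) / (y + 1 / B)], so the new [r]
    is [1 / B]. *)
Lemma pole_form_add b g :
  2 <= b -> pole_form g -> pole_form (fun y => g (b + 1 / y)).
Proof.
  intros Hb (E & k & r & Hk & Hr & Hg).
  exists (E + k / (b + r)), (- k / (b + r) ^ 2), (1 / (b + r)).
  assert (D : 1.6 <= b + r) by lra.
  assert (P : 1 / (b + r) * (b + r) = 1) by (field; lra).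
  repeat split.
  - intros H. apply Hk.
    replace k with (- (- k / (b + r) ^ 2) * (b + r) ^ 2) by (field; lra).
    rewrite H. ring.
  - nra.
  - nra.
  - intros y Hy.
    assert (0 < 1 / y) by (apply Rdiv_lt_0_compat; lra).
    rewrite Hg by lra.
    assert (0 < y * (b + r) + 1) by nra.
    field. repeat split; try lra; nra.
Qed.

(** The same computation gives the new [r] as [- 1 / (b + r)]. Here [b] is at least 3, since [b = 2]
    could push it below [- 2 / 5]. *)
Lemma pole_form_sub b g :
  3 <= b -> pole_form g -> pole_form (fun y => g (b - 1 / y)).
Proof.
  intros Hb (E & k & r & Hk & Hr & Hg).
  exists (E + k / (b + r)), (k / (b + r) ^ 2), (- (1 / (b + r))).
  assert (D : 2.6 <= b + r) by lra.
  assert (P : 1 / (b + r) * (b + r) = 1) by (field; lra).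
  repeat split.
  - intros H. apply Hk.
    replace k with ((k / (b + r) ^ 2) * (b + r) ^ 2) by (field; lra).
    rewrite H. ring.
  - nra.
  - nra.
  - intros y Hy.
    assert (1 / y < 1).
    { apply Rmult_lt_reg_r with y; [lra|]. field_simplify; lra. }
    rewrite Hg by lra.
    assert (0 < y * (b + r) - 1) by nra.
    field. repeat split; try lra; nra.
Qed.

(** The affine part of the pole form is harmless, and [1 / (u + r) - 1 / (v + r) = (v - u) / ((u +
    r) * (v + r))]. Cancelling common factors leaves inequalities linear in [r]. *)
Lemma pole_form_bridged g y0 y1 y2 y3 :
  pole_form g -> 1 < y0 -> y0 < y1 -> y1 < y2 -> y2 < y3 ->
  (forall r, - (2 / 5) <= r <= 5 / 8 ->
     (y2 - y1) * (y0 + r) <= (y1 - y0) * (y2 + r) /\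
     (y2 - y1) * (y3 + r) <= (y3 - y2) * (y1 + r)) ->
  bridged (g y0) (g y1) (g y2) (g y3).
Proof.
  intros (E & k & r & Hk & Hr & Hg) H0 H1 H2 H3 H.
  rewrite !Hg by lra. apply bridged_affine; [assumption|].
  destruct (H r Hr) as [A B].
  assert (Hd : forall u v, 1 < u -> 1 < v ->
    / (u + r) - / (v + r) = (v - u) * (/ (u + r) * / (v + r))).
  { intros. field. lra. }
  assert (Hi : forall u, 1 < u -> 0 < / (u + r)).
  { intros. apply Rinv_0_lt_compat. lra. }
  assert (Hp : forall u v, 1 < u -> u < v -> / (v + r) < / (u + r)).
  { intros. apply Rinv_lt_contravar; [nra | lra]. }
  (* The map [y] to [1 / (y + r)] is decreasing, so the four points come in reverse order. *)
  right. unfold bridge. repeat split; try (apply Hp; lra).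
  - rewrite !Hd by lra.
    replace ((y2 - y1) * (/ (y1 + r) * / (y2 + r))) with
      ((y2 - y1) * (y3 + r) * (/ (y1 + r) * / (y2 + r) * / (y3 + r))) by (field; lra).
    replace ((y3 - y2) * (/ (y2 + r) * / (y3 + r))) with
      ((y3 - y2) * (y1 + r) * (/ (y1 + r) * / (y2 + r) * / (y3 + r))) by (field; lra).
    apply Rmult_le_compat_r; [|assumption].
    left. repeat apply Rmult_lt_0_compat; apply Hi; lra.
  - rewrite !Hd by lra.
    replace ((y2 - y1) * (/ (y1 + r) * / (y2 + r))) with
      ((y2 - y1) * (y0 + r) * (/ (y0 + r) * / (y1 + r) * / (y2 + r))) by (field; lra).
    replace ((y1 - y0) * (/ (y0 + r) * / (y1 + r))) with
      ((y1 - y0) * (y2 + r) * (/ (y0 + r) * / (y1 + r) * / (y2 + r))) by (field; lra).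
    apply Rmult_le_compat_r; [|assumption].
    left. repeat apply Rmult_lt_0_compat; apply Hi; lra.
Qed.

Lemma pole_form_gap_le g y1 y2 z1 z2 :
  pole_form g -> 1 < y1 -> y1 < y2 -> 1 < z1 -> z1 < z2 ->
  (forall r, - (2 / 5) <= r <= 5 / 8 ->
     (z2 - z1) * ((y1 + r) * (y2 + r)) <= (y2 - y1) * ((z1 + r) * (z2 + r))) ->
  Rabs (g z1 - g z2) <= Rabs (g y1 - g y2).
Proof.
  intros (E & k & r & Hk & Hr & Hg) H0 H1 H2 H3 H.
  specialize (H r Hr). rewrite !Hg by lra.
  replace (E + k * / (z1 + r) - (E + k * / (z2 + r))) with
    (k * ((z2 - z1) / ((z1 + r) * (z2 + r)))) by (field; lra).
  replace (E + k * / (y1 + r) - (E + k * / (y2 + r))) with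
    (k * ((y2 - y1) / ((y1 + r) * (y2 + r)))) by (field; lra).
  rewrite !Rabs_mult. apply Rmult_le_compat_l; [apply Rabs_pos|].
  assert (0 < (y1 + r) * (y2 + r)) by nra.
  assert (0 < (z1 + r) * (z2 + r)) by nra.
  rewrite !Rabs_right;
    try (apply Rle_ge; left; apply Rdiv_lt_0_compat; lra).
  apply Rmult_le_reg_r with ((y1 + r) * (y2 + r) * ((z1 + r) * (z2 + r))); [nra|].
  replace ((z2 - z1) / ((z1 + r) * (z2 + r)) *
    ((y1 + r) * (y2 + r) * ((z1 + r) * (z2 + r)))) with
    ((z2 - z1) * ((y1 + r) * (y2 + r))) by (field; lra).
  replace ((y2 - y1) / ((y1 + r) * (y2 + r)) *
    ((y1 + r) * (y2 + r) * ((z1 + r) * (z2 + r)))) with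
    ((y2 - y1) * ((z1 + r) * (z2 + r))) by (field; lra).
  assumption.
Qed.

(** * Length estimates for the configurations of digits *)

Lemma bridged_2_5 g : pole_form g ->
  bridged (g (2 + delta)) (g (3 - delta)) (g (3 + delta)) (g (5 - delta)).
Proof.
  intros G. pose proof delta_bounds.
  apply pole_form_bridged; try assumption; try lra.
  intros r Hr. split; nra.
Qed.

Lemma bridged_3_5 g : pole_form g ->
  bridged (g (3 + delta)) (g (4 - delta)) (g (4 + delta)) (g (5 - delta)).
Proof.
  intros G. pose proof delta_bounds.
  apply pole_form_bridged; try assumption; try lra.
  intros r Hr. split; nra.
Qed.

Lemma bridged_unit g b : pole_form g -> 2 <= b ->
  bridged (g (b + delta)) (g (b + inv2)) (g (b + 1 - inv2)) (g (b + 1 - delta)).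
Proof.
  intros G Hb. pose proof delta_bounds. pose proof inv2_bounds.
  apply pole_form_bridged; try assumption; try lra.
  intros r Hr. split; nra.
Qed.

Lemma gap_3_4 g : pole_form g ->
  Rabs (g (4 - delta) - g (4 + delta)) <= Rabs (g (3 - delta) - g (3 + delta)).
Proof.
  intros G. pose proof delta_bounds.
  apply pole_form_gap_le; try assumption; try lra.
  intros r Hr. nra.
Qed.

(** Separates the two effects in [pole_form_gap_le]: [m] bounds the ratio of the products of
    distances to the pole, while [d] and [e] are the gap lengths before distortion. *)
Lemma Rmult_le_ratio d e A B m :
  0 <= d -> 0 < B -> A <= m * B -> d * m <= e -> d * A <= e * B.
Proof.
  intros Hd HB HA He. apply Rle_trans with (d * (m * B)).
  - now apply Rmult_le_compat_l.
  - rewrite <- Rmult_assoc. apply Rmult_le_compat_r; lra.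
Qed.

Lemma gap_unit_le g b c : pole_form g -> 2 <= b -> c <= b + 1 -> 2 <= c ->
  Rabs (g (b + inv2) - g (b + 1 - inv2)) <= Rabs (g (c - delta) - g (c + delta)).
Proof.
  intros G Hb Hc Hc2. pose proof delta_bounds. pose proof inv2_bounds.
  apply pole_form_gap_le; try assumption; try lra.
  (* Since [b + r >= 1.6], each outer distance to the pole is at most 1.5 times its inner
     counterpart, and [2.25 * (1 - 2 * inv2)] is still below [2 * delta]. *)
  intros r Hr. apply (Rmult_le_ratio _ _ _ _ (1.5 * 1.5)); try lra.
  - apply Rmult_lt_0_compat; lra.
  - apply Rle_trans with ((1.5 * (b + inv2 + r)) * (1.5 * (b + 1 - inv2 + r)));
      [apply Rmult_le_compat; lra | lra].
Qed.

Lemma gap_add_le g b : pole_form g -> 2 <= b ->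
  Rabs (g (b + 1 / (3 - delta)) - g (b + 1 / (3 + delta))) <=
  Rabs (g (b + inv2) - g (b + 1 - inv2)).
Proof.
  intros G Hb. pose proof inv3m_bounds. pose proof inv3p_bounds.
  pose proof inv2_bounds. rewrite Rabs_minus_sym.
  apply pole_form_gap_le; try assumption; try lra.
  intros r Hr.
  set (u := 1 / (3 - delta)) in *. set (v := 1 / (3 + delta)) in *.
  apply (Rmult_le_ratio _ _ _ _ (1.15 * 1.15)); try lra.
  - apply Rmult_lt_0_compat; lra.
  - apply Rle_trans with ((1.15 * (b + v + r)) * (1.15 * (b + u + r)));
      [apply Rmult_le_compat; lra | lra].
Qed.

Lemma gap_sub_le g b : pole_form g -> 2 <= b ->
  Rabs (g (b + 1 - 1 / (3 - delta)) - g (b + 1 - 1 / (3 + delta))) <=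
  Rabs (g (b + inv2) - g (b + 1 - inv2)).
Proof.
  intros G Hb. pose proof inv3m_bounds. pose proof inv3p_bounds.
  pose proof inv2_bounds.
  apply pole_form_gap_le; try assumption; try lra.
  intros r Hr.
  set (u := 1 / (3 - delta)) in *. set (v := 1 / (3 + delta)) in *.
  (* The ends of the child's gap lie farther from the pole than those of the parent's gap, so the
     factor 1 suffices. *)
  apply (Rmult_le_ratio _ _ _ _ 1); try lra.
  - apply Rmult_lt_0_compat; lra.
  - rewrite Rmult_1_l. apply Rmult_le_compat; lra.
Qed.

(** * The interval tree of the Cantor set *)

Lemma cf_app a b z : cf (a ++ b) z = cf a (cf b z).
Proof. induction a as [|k a IH]; simpl; congruence. Qed.

Lemma Pplus_cf k a : Pplus k a = cf a (IZR k + delta).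
Proof. unfold Pplus. now rewrite cf_app. Qed.

Lemma Pminus_cf k a : Pminus k a = cf a (IZR k - delta).
Proof.
  unfold Pminus. rewrite cf_app. simpl. f_equal. unfold delta.
  pose proof mu_bounds. field. lra.
Qed.

Lemma Pplus_snoc k a b : Pplus k (a ++ [b]) = cf a (IZR b + 1 / (IZR k + delta)).
Proof. rewrite Pplus_cf, cf_app. reflexivity. Qed.

Lemma Pminus_snoc k a b : Pminus k (a ++ [b]) = cf a (IZR b + 1 / (IZR k - delta)).
Proof. rewrite Pminus_cf, cf_app. reflexivity. Qed.

Lemma inv_m2 : 1 / (-2 - delta) = - inv2.
Proof. pose proof delta_bounds. unfold inv2. field. lra. Qed.

Lemma inv_m3m : 1 / (-3 - delta) = - (1 / (3 + delta)).
Proof. pose proof delta_bounds. field. lra. Qed.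

Lemma inv_m3p : 1 / (-3 + delta) = - (1 / (3 - delta)).
Proof. pose proof delta_bounds. field. lra. Qed.

Lemma inv_m5 : 1 / (-5 + delta) = - delta.
Proof. rewrite <- delta_fixed at 2. pose proof delta_bounds. field. lra. Qed.

(** Functional form of [splits], as the abstract tree needs child maps. Consecutive digits are
    tested first, because [T 2 3 a] and [T 3 4 a] share their first digit with [T 2 5 a] and
    [T 3 5 a]. *)
Definition rule (I : interval) : R * R * interval * interval :=
  match I with
  | T01 => (cf [0; 2]%Z mu, cf [1; -2]%Z (- mu), T 2 5 [0%Z], T (-5) (-2) [1%Z])
  | T u v a =>
      if (v =? u + 1)%Z then
        (Pplus 2 (a ++ [u]), Pminus (-2) (a ++ [v]),
         T 2 5 (a ++ [u]), T (-5) (-2) (a ++ [v]))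
      else if (u =? 2)%Z then (Pminus 3 a, Pplus 3 a, T 2 3 a, T 3 5 a)
      else if (u =? 3)%Z then (Pminus 4 a, Pplus 4 a, T 3 4 a, T 4 5 a)
      else if (v =? -2)%Z then
        (Pminus (-3) a, Pplus (-3) a, T (-5) (-3) a, T (-3) (-2) a)
      else (Pminus (-4) a, Pplus (-4) a, T (-5) (-4) a, T (-4) (-3) a)
  end.

Lemma splits_rule I p q J K : splits I p q J K -> rule I = (p, q, J, K).
Proof.
  intros H. destruct H; try reflexivity.
  unfold rule. now rewrite Z.eqb_refl.
Qed.

Definition ends (I : interval) : R * R :=
  match I with
  | T01 => (1 / mu, 1 - 1 / mu)
  | T u v a => (Pplus u a, Pminus v a)
  end.

Definition lo (I : interval) : R := Rmin (fst (ends I)) (snd (ends I)).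
Definition hi (I : interval) : R := Rmax (fst (ends I)) (snd (ends I)).

Definition gap_length (I : interval) : R :=
  let '(p, q, _, _) := rule I in Rabs (p - q).

(** The rules list the pieces by digit; their order on the real line depends on parity and is
    recovered by comparing [lo]. *)
Definition left_child (I : interval) : interval :=
  let '(_, _, J, K) := rule I in if Rle_dec (lo J) (lo K) then J else K.
Definition right_child (I : interval) : interval :=
  let '(_, _, J, K) := rule I in if Rle_dec (lo J) (lo K) then K else J.

(** An invariant closed under splitting which retains, besides the pair of digits, only the pole
    form of the prefix. *)
Definition good (I : interval) : Prop :=
  match I with
  | T01 => True
  | T u v a =>
      (pole_form (cf a) /\
       In (u, v) [(2, 5); (3, 5); (2, 3); (3, 4); (4, 5)]%Z) \/
      (pole_form (fun y => cf a (- y)) /\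
       In (u, v) [(-5, -2); (-5, -3); (-5, -4); (-4, -3); (-3, -2)]%Z)
  end.

(** Collects all that is to be checked for one split without fixing an orientation: [J] has ends
    [s], [p] and [K] has ends [q], [t]. *)
Definition layout (I : interval) : Prop :=
  let '(p, q, J, K) := rule I in
  let (s, t) := ends I in
  (good J /\ good K) /\ bridged s p q t /\
  (lo J = Rmin s p /\ hi J = Rmax s p) /\
  (lo K = Rmin q t /\ hi K = Rmax q t) /\
  gap_length J <= Rabs (p - q) /\ gap_length K <= Rabs (p - q).

(** * Checking the layout of every good interval *)

Lemma bridged_eq s p q t s' p' q' t' :
  bridged s p q t -> s = s' -> p = p' -> q = q' -> t = t' -> bridged s' p' q' t'.
Proof. now intros; subst. Qed.

Lemma gap_eq a b c d a' b' c' d' :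
  Rabs (a - b) <= Rabs (c - d) ->
  (a = a' /\ b = b') \/ (a = b' /\ b = a') ->
  (c = c' /\ d = d') \/ (c = d' /\ d = c') ->
  Rabs (a' - b') <= Rabs (c' - d').
Proof.
  intros H [[-> ->] | [-> ->]] [[-> ->] | [-> ->]];
  first [ exact H | rewrite (Rabs_minus_sym a'); exact H
        | rewrite (Rabs_minus_sym c'); exact H
        | rewrite (Rabs_minus_sym a'), (Rabs_minus_sym c'); exact H ].
Qed.

Ltac cf_eq := rewrite ?Pplus_snoc, ?Pminus_snoc, ?Pplus_cf, ?Pminus_cf;
  rewrite ?inv_m2, ?inv_m3m, ?inv_m3p, ?inv_m5, ?delta_fixed;
  try change (1 / (2 + delta)) with inv2; f_equal; lra.

Ltac use_bridged H :=
  first [ apply (bridged_eq _ _ _ _ _ _ _ _ H); cf_eq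
        | apply (bridged_eq _ _ _ _ _ _ _ _ (bridged_sym _ _ _ _ H)); cf_eq ].

Ltac use_gap H := apply (gap_eq _ _ _ _ _ _ _ _ H);
  first [ left; split; cf_eq | right; split; cf_eq ].

Ltac end_eq := first [ reflexivity
  | rewrite Rmin_comm; unfold lo; simpl; f_equal; cf_eq
  | rewrite Rmax_comm; unfold hi; simpl; f_equal; cf_eq ].

Ltac use_pole H := eapply pole_form_ext; [| exact H];
  intros; simpl; rewrite cf_app; simpl; f_equal; field; lra.

Ltac layout_unit G b :=
  repeat split; try end_eq;
  [ left; split; [|tauto];
    first [ use_pole (pole_form_add b _ ltac:(lra) G)
          | use_pole (pole_form_sub (b + 1) _ ltac:(lra) G) ]
  | right; split; [|tauto];
    first [ use_pole (pole_form_add b _ ltac:(lra) G)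
          | use_pole (pole_form_sub (b + 1) _ ltac:(lra) G) ]
  | use_bridged (bridged_unit _ b G ltac:(lra))
  | first [ use_gap (gap_add_le _ b G ltac:(lra))
          | use_gap (gap_sub_le _ b G ltac:(lra)) ]
  | first [ use_gap (gap_add_le _ b G ltac:(lra))
          | use_gap (gap_sub_le _ b G ltac:(lra)) ] ].

Ltac layout_2_5 G :=
  repeat split; try tauto; try reflexivity;
  [ use_bridged (bridged_2_5 _ G)
  | first [ use_gap (gap_unit_le _ 2 3 G ltac:(lra) ltac:(lra) ltac:(lra))
          | use_gap (gap_3_4 _ G) ]
  | first [ use_gap (gap_unit_le _ 2 3 G ltac:(lra) ltac:(lra) ltac:(lra))
          | use_gap (gap_3_4 _ G) ] ].

Ltac layout_3_5 G :=
  repeat split; try tauto; try reflexivity;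
  [ use_bridged (bridged_3_5 _ G)
  | first [ use_gap (gap_unit_le _ 3 4 G ltac:(lra) ltac:(lra) ltac:(lra))
          | use_gap (gap_unit_le _ 4 4 G ltac:(lra) ltac:(lra) ltac:(lra)) ]
  | first [ use_gap (gap_unit_le _ 3 4 G ltac:(lra) ltac:(lra) ltac:(lra))
          | use_gap (gap_unit_le _ 4 4 G ltac:(lra) ltac:(lra) ltac:(lra)) ] ].

Lemma layout_T01 : layout T01.
Proof.
  pose proof delta_bounds. pose proof inv2_bounds.
  pose proof inv3m_bounds. pose proof inv3p_bounds.
  unfold layout, rule at 1, ends at 1.
  change (cf [0; 2]%Z mu) with (Pplus 2 [0%Z]).
  change (cf [1; -2]%Z (- mu)) with (Pminus (-2) [1%Z]).
  change (gap_length (T 2 5 [0%Z])) with (Rabs (Pminus 3 [0%Z] - Pplus 3 [0%Z])).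
  change (gap_length (T (-5) (-2) [1%Z])) with
    (Rabs (Pminus (-3) [1%Z] - Pplus (-3) [1%Z])).
  change [0%Z] with ([] ++ [0%Z]). change [1%Z] with ([] ++ [1%Z]).
  unfold lo, hi, ends, fst, snd.
  rewrite ?Pplus_snoc, ?Pminus_snoc.
  rewrite ?inv_m2, ?inv_m3m, ?inv_m3p, ?inv_m5, ?delta_fixed.
  change (1 / (2 + delta)) with inv2. change (1 / mu) with delta.
  simpl cf. rewrite !Rplus_0_l. fold (1 - delta) (1 - inv2).
  repeat split; try apply Rmin_comm; try apply Rmax_comm.
  (* Base cases of the pole forms: [cf [0] y = 1 / y] and, in the next item, [cf [1] (- y) = 1 - 1 /
     y]. *)
  - left. split; [|now left]. exists 0, 1, 0.
    repeat split; try lra. intros y Hy. simpl. field. lra.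
  - right. split; [|now left]. exists 1, (-1), 0.
    repeat split; try lra. intros y Hy. simpl. field. lra.
  - left. unfold bridge. lra.
  - rewrite Rabs_right, Rabs_left; lra.
  - rewrite Rabs_right, Rabs_left; lra.
Qed.

Lemma layout_good I : good I -> layout I.
Proof.
  destruct I as [|u v a]; [intros _; apply layout_T01|].
  pose proof delta_bounds as D.
  intros [[G H] | [G H]]; simpl in H;
  repeat (destruct H as [H | H]; [injection H as <- <-|]); try contradiction;
  unfold layout; simpl.
  - layout_2_5 G.
  - layout_3_5 G.
  - layout_unit G 2.
  - layout_unit G 3.
  - layout_unit G 4.
  (* The negative digit pairs mirror the positive ones through [y] to [- y], with the four points in
     reverse order; the argument of [layout_unit] is the smaller absolute value of the two
     digits. *)
  - layout_2_5 G.
  - layout_3_5 G.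
  - layout_unit G 4.
  - layout_unit G 3.
  - layout_unit G 2.
Qed.

(** The direction of the bridged quadruple decides which of [J] and [K] is on the left, turning the
    unordered layout into ordered endpoints. *)
Lemma layout_children I p q J K :
  layout I -> rule I = (p, q, J, K) ->
  (left_child I = J /\ right_child I = K \/ left_child I = K /\ right_child I = J) /\
  lo (left_child I) = lo I /\ hi (left_child I) = Rmin p q /\
  lo (right_child I) = Rmax p q /\ hi (right_child I) = hi I /\
  Rmin p q < Rmax p q /\ Rmax p q - Rmin p q = Rabs (p - q) /\
  Rmax p q - Rmin p q <= Rmin p q - lo I /\
  Rmax p q - Rmin p q <= hi I - Rmax p q.
Proof.
  unfold layout, left_child, right_child. intros H E. rewrite E in *.
  assert (L : lo I = Rmin (fst (ends I)) (snd (ends I))) by reflexivity.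
  assert (U : hi I = Rmax (fst (ends I)) (snd (ends I))) by reflexivity.
  destruct (ends I) as [s t]. simpl in L, U. rewrite L, U.
  destruct H as (_ & B & [J1 J2] & [K1 K2] & _).
  destruct B as [(A1 & A2 & A3 & A4 & A5) | (A1 & A2 & A3 & A4 & A5)].
  - rewrite (Rmin_left s p), (Rmax_right s p) in * by lra.
    rewrite (Rmin_left q t), (Rmax_right q t) in * by lra.
    rewrite (Rmin_left s t), (Rmax_right s t) by lra.
    rewrite (Rmin_left p q), (Rmax_right p q) by lra.
    rewrite Rabs_left by lra.
    destruct Rle_dec; [|lra]. repeat split; solve [lra | tauto].
  - rewrite (Rmin_right s p), (Rmax_left s p) in * by lra.
    rewrite (Rmin_right q t), (Rmax_left q t) in * by lra.
    rewrite (Rmin_right s t), (Rmax_left s t) by lra.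
    rewrite (Rmin_right p q), (Rmax_left p q) by lra.
    rewrite Rabs_right by lra.
    destruct Rle_dec; [lra|]. repeat split; solve [lra | tauto].
Qed.

Lemma gap_length_children I : good I ->
  lo (right_child I) - hi (left_child I) = gap_length I.
Proof.
  intros G. apply layout_good in G.
  destruct (rule I) as [[[p q] J] K] eqn:E.
  destruct (layout_children _ _ _ _ _ G E) as (_ & _ & H1 & H2 & _ & _ & H3 & _).
  unfold gap_length. rewrite E, H1, H2. assumption.
Qed.

Lemma bridged_tree_NICF : bridged_tree lo hi left_child right_child good.
Proof.
  assert (C : forall I, good I ->
    (good (left_child I) /\ gap_length (left_child I) <= gap_length I) /\
    (good (right_child I) /\ gap_length (right_child I) <= gap_length I)).
  { intros I G. apply layout_good in G.
    destruct (rule I) as [[[p q] J] K] eqn:E.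
    destruct (layout_children _ _ _ _ _ G E) as [H _].
    unfold layout in G. unfold gap_length at 2 4. rewrite E in *.
    destruct (ends I). destruct H as [[-> ->] | [-> ->]]; tauto. }
  split; intros I G; try apply (C I G);
  try (rewrite !gap_length_children by (try assumption; apply (C I G));
       apply (C I G));
  apply layout_good in G;
  destruct (rule I) as [[[p q] J] K] eqn:E;
  pose proof (layout_children _ _ _ _ _ G E); lra.
Qed.

(** * From the interval tree to [C_NICF] *)

Lemma family_descendant I :
  family I -> descendant left_child right_child T01 I.
Proof.
  intros F. induction F as [|I p q J K _ IH S|I p q J K _ IH S];
    [apply descendant_refl | |];
  apply splits_rule in S;
  pose proof (descendant_l _ _ _ _ IH) as HL;
  pose proof (descendant_r _ _ _ _ IH) as HR;
  unfold left_child at 2 in HL; unfold right_child at 2 in HR;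
  rewrite S in HL, HR; destruct Rle_dec; assumption.
Qed.

(** Each interval of [family] is a node of the tree, and its gap under [splits] is the gap of that
    node, so a point missing all gaps of the tree misses every removed gap. *)
Lemma cantor_C_NICF a : cantor lo hi left_child right_child T01 a -> C_NICF a.
Proof.
  intros [Ha H]. split; [exact Ha|].
  intros (I & p & q & J & K & F & S & Hpq).
  apply family_descendant in F. apply (H I F).
  apply (good_descendant lo hi _ _ good T01 _ bridged_tree_NICF Logic.I) in F.
  apply layout_good in F. apply splits_rule in S.
  destruct (layout_children _ _ _ _ _ F S) as (_ & _ & -> & -> & _).
  exact Hpq.
Qed.

Theorem theorem5p7 (x : R) (hx : 2 / mu <= x <= 2 - 2 / mu) :
  exists a b : R, C_NICF a /\ C_NICF b /\ a + b = x.
Proof.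
  destruct (sum_of_cantor lo hi left_child right_child good T01 x)
    as (a & b & Ca & Cb & E).
  - exact bridged_tree_NICF.
  - exact Logic.I.
  - pose proof delta_bounds. unfold lo, hi, ends, fst, snd.
    change (1 / mu) with delta.
    replace (2 / mu) with (2 * delta) in hx by (unfold delta; lra).
    rewrite Rmin_left, Rmax_right; lra.
  - exists a, b. auto using cantor_C_NICF.
Qed.
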